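(* Let $\alpha\in\mathbb{C}$. Then there is a finite subset $F$ of $\mathbb{Z}$ such that $F[\alpha]=\mathbb{Z}[\alpha]$ if and only if $\alpha$ is an algebraic number whose conjugates over $\mathbb{Q}$ are either all of modulus one, or all of modulus greater than one.
   Context: For a set $F\subset\mathbb{C}$ and $\alpha\in\mathbb{C}$, $F[\alpha]:=\left\{\sum_{j=0}^{n}\varepsilon_j\alpha^j \mid (\varepsilon_0,\dots,\varepsilon_n)\in F^{n+1},\ n\in\mathbb{N}\right\}$, where $\mathbb{N}$ is the set of non-negative integers. $\mathbb{Z}[\alpha]$ denotes the ring of all polynomials with integer coefficients evaluated at $\alpha$. *)

(* Defs.v *)
From mathcomp Require Import all_boot all_order all_algebra.
From mathcomp Require Import classical_sets cardinality reals.
From mathcomp Require Import complex.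

Set Implicit Arguments.
Unset Strict Implicit.
Unset Printing Implicit Defensive.

Import Order.TTheory GRing.Theory Num.Theory.
Local Open Scope classical_set_scope.
Local Open Scope ring_scope.

Definition digit_expansions (C : numClosedFieldType) (F : set C) (a : C) : set C :=
  [set x | exists (n : nat) (e : 'I_n.+1 -> C),
    (forall j, F (e j)) /\ x = \sum_(j < n.+1) e j * a ^+ j].

Definition int_adjoin (C : numClosedFieldType) (a : C) : set C :=
  [set x | exists p : {poly int}, x = (map_poly intr p).[a]].

Definition is_minpoly (C : numClosedFieldType) (a : C) (p : {poly rat}) : Prop :=
  [/\ p \is monic, irreducible_poly p & root (map_poly ratr p) a].

(* When [a] is transcendental it has no minimal polynomial, and no [b]
   satisfies this predicate. *)
Definition rat_conjugate (C : numClosedFieldType) (a b : C) : Prop :=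
  exists2 p : {poly rat}, is_minpoly a p & root (map_poly ratr p) b.

(* Main.v *)
(** If every conjugate [z] of [alpha] satisfies [1 <= |z|], let [P] be an
    integer multiple of the minimal polynomial, and divide: every integer
    polynomial [Q] is congruent mod [P] to [e + 'X * Q1] with [|e| <= |P`_0|],
    where [e] may be taken nonzero and of either sign.  Choosing [e] with the
    sign of the trace [tr Q], the sum of [Q(z)] over the conjugates, the squared
    norm [N2 Q], the sum of the [|Q(z)|^2], changes by at most
    [- 2 |tr Q| + d |P`_0|^2], with [d] the degree of [P].  The power sums of
    the [Q(z) z^-j], [j < d], are bounded perturbations of the traces met in the
    first [d] divisions and determine the values [Q(z)], so [N2] drops by at
    least 1 in [d] divisions as long as it is large.  Hence the divisions end
    in a bounded set of polynomials of degree [< d], whose own coefficients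
    serve as the leading digits.

    Conversely, representing a large integer with bounded digits makes [alpha]
    algebraic, and a conjugate of modulus less than 1 would bound all integers.
    If some conjugate [b] has modulus 1 then [b^-1], its complex conjugate, is
    a root of the minimal polynomial, which is therefore reciprocal: no
    conjugate can have modulus greater than 1. *)
Require Import Defs.
From mathcomp Require Import all_boot all_order all_algebra.
From mathcomp Require Import boolp classical_sets cardinality reals.
From mathcomp Require Import complex separable ring.

Set Implicit Arguments.
Unset Strict Implicit.
Unset Printing Implicit Defensive.

Import Order.TTheory GRing.Theory Num.Theory.
Local Open Scope classical_set_scope.
Local Open Scope ring_scope.

(** * Evaluation of integer polynomials and bounds by Lagrange interpolation *)

Definition eval_int (C : numClosedFieldType) (p : {poly int}) (z : C) : C :=
  (map_poly intr p).[z].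

(** A [numClosedFieldType] may be non-Archimedean; this condition makes the descent on norms
    terminate and excludes conjugates of modulus less than 1. *)
Definition archimedean_norm (C : numClosedFieldType) : Prop :=
  forall x : C, exists n : nat, `|x| <= n%:R.

Lemma lagrange_basis (F : fieldType) (s : seq F) : uniq s ->
  exists l : F -> {poly F}, forall z, z \in s ->
    (size (l z) <= size s)%N /\ {in s, forall w, (l z).[w] = (w == z)%:R}.
Proof.
move=> us; pose m z := \prod_(w <- rem z s) ('X - w%:P).
exists (fun z => (m z).[z]^-1 *: m z) => z zs; split.
  rewrite (leq_trans (size_scale_leq _ _))// size_prod_XsubC size_rem//.
  by case: (s) zs.
move=> w ws; rewrite hornerZ; case: eqVneq => [->|wz].
  rewrite mulVf// -[_ == 0]/(root _ _) root_prod_XsubC.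
  by rewrite mem_rem_uniq// inE eqxx.
have /rootP -> : root (m z) w; last by rewrite mulr0.
by rewrite root_prod_XsubC mem_rem_uniq// inE wz.
Qed.

(** Weighting the power sums by the coefficients of the Lagrange polynomial at [z] leaves only
    [f z]. *)
Lemma power_sums_bound (C : numClosedFieldType) (s : seq C) : uniq s ->
  exists2 L : C, 0 <= L & forall (f : C -> C) (K : C),
    (forall j, (j < size s)%N -> `|\sum_(z <- s) f z * z ^+ j| <= K) ->
    {in s, forall z, `|f z| <= L * K}.
Proof.
move=> us; have [l lP] := lagrange_basis us.
pose b z := \sum_(j < size s) `|(l z)`_j|.
have b0 z : 0 <= b z by apply: sumr_ge0.
exists (\sum_(z <- s) b z); first exact: sumr_ge0.
move=> f K fK z zs; have [sl lz] := lP z zs.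
have K0 : 0 <= K.
  apply: le_trans (fK 0 _); first exact: normr_ge0.
  by case: (s) zs.
have -> : f z = \sum_(j < size s) (l z)`_j * \sum_(w <- s) f w * w ^+ j.
  under eq_bigr do rewrite mulr_sumr.
  have lf w : w \in s ->
      \sum_(j < size s) (l z)`_j * (f w * w ^+ j) = f w * (w == z)%:R.
    move=> ws; rewrite -lz// (horner_coef_wide _ sl) mulr_sumr.
    by apply: eq_bigr => i _; rewrite mulrCA.
  rewrite exchange_big/= (bigD1_seq z)//= lf// eqxx mulr1.
  rewrite big_seq_cond big1 ?addr0// => w /andP[ws wz].
  by rewrite lf// (negbTE wz) mulr0.
apply: (@le_trans _ _ (b z * K)); last first.
  by apply: ler_wpM2r => //; rewrite (bigD1_seq z)//= lerDl sumr_ge0.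
rewrite mulr_suml; apply: le_trans (ler_norm_sum _ _ _) _.
by apply: ler_sum => j _; rewrite normrM ler_wpM2l// fK.
Qed.

(** At this size [p] equals its Lagrange interpolant, so its coefficients are fixed linear
    combinations of its values. *)
Lemma coef_bound (C : numClosedFieldType) (s : seq C) : uniq s ->
  exists2 L : C, 0 <= L & forall (p : {poly C}) (K : C), 0 <= K ->
    (size p <= size s)%N -> {in s, forall z, `|p.[z]| <= K} ->
    forall i, `|p`_i| <= L * K.
Proof.
move=> us; have [l lP] := lagrange_basis us.
pose b i := \sum_(z <- s) `|(l z)`_i|.
have b0 i : 0 <= b i by apply: sumr_ge0.
exists (\sum_(i < size s) b i); first exact: sumr_ge0.
move=> p K K0 sp pK i.
have [si|si] := leqP (size s) i.
  by rewrite nth_default ?(leq_trans sp)// normr0 mulr_ge0// sumr_ge0.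
have pE : p = \sum_(z <- s) p.[z] *: l z.
  apply/eqP; rewrite -subr_eq0; apply/eqP.
  apply: (@roots_geq_poly_eq0 _ _ s) => //.
    apply/allP => w ws; rewrite rootE !hornerE horner_sum (bigD1_seq w)//=.
    have [_ lw] := lP w ws; rewrite hornerZ lw// eqxx mulr1.
    rewrite big_seq_cond big1 ?addr0 ?subrr// => z /andP[zs zw].
    by have [_ lz] := lP z zs; rewrite hornerZ lz// eq_sym (negbTE zw) mulr0.
  rewrite (leq_trans (size_polyD _ _))// geq_max sp size_polyN.
  rewrite big_seq; apply: (big_ind (fun q : {poly C} => size q <= size s)%N).
  - by rewrite size_poly0.
  - by move=> q r sq sr; rewrite (leq_trans (size_polyD _ _))// geq_max sq.
  move=> z zs.
  by rewrite (leq_trans (size_scale_leq _ _))//; have [] := lP z zs.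
apply: (@le_trans _ _ (b i * K)); last first.
  apply: ler_wpM2r => //.
  by rewrite (bigD1 (Ordinal si))//= lerDl sumr_ge0.
rewrite pE coef_sum mulr_suml; apply: le_trans (ler_norm_sum _ _ _) _.
rewrite big_seq [leRHS]big_seq; apply: ler_sum => z zs.
by rewrite coefZ normrM mulrC ler_wpM2l// pK.
Qed.

Lemma eval_intD (C : numClosedFieldType) p q (z : C) :
  eval_int (p + q) z = eval_int p z + eval_int q z.
Proof. by rewrite /eval_int rmorphD hornerD. Qed.

Lemma eval_intM (C : numClosedFieldType) p q (z : C) :
  eval_int (p * q) z = eval_int p z * eval_int q z.
Proof. by rewrite /eval_int rmorphM hornerM. Qed.

Lemma eval_intC (C : numClosedFieldType) a (z : C) : eval_int a%:P z = a%:~R.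
Proof. by rewrite /eval_int map_polyC hornerC. Qed.

Lemma eval_intX (C : numClosedFieldType) (z : C) : eval_int 'X z = z.
Proof. by rewrite /eval_int map_polyX hornerX. Qed.

Lemma eval_int_conj (C : numClosedFieldType) p (z : C) :
  eval_int p z^* = (eval_int p z)^*.
Proof.
rewrite /eval_int -horner_map -map_poly_comp; congr (_.[_]).
by apply: eq_map_poly => a /=; rewrite rmorph_int.
Qed.

(* Excluding [e = 0] is what makes the trace term of [N2_shift] effective. *)
Lemma signed_residue (m q : int) (b : bool) : m != 0 ->
  exists e k : int, [/\ q = e + k * m, `|e| <= `|m| & 1 <= (-1) ^+ b * e].
Proof.
(* Subtracting 1 before the division and adding it back moves the remainder from [0 .. |m| - 1] to
   [1 .. |m|]. *)
move=> m0; pose r := (((-1) ^+ b * q - 1) %% m)%Z.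
pose k := (((-1) ^+ b * q - 1) %/ m)%Z.
have E : (-1) ^+ b * q - 1 = k * m + r := divz_eq _ _.
have r0 : 0 <= r := modz_ge0 _ m0.
have rm : r < `|m| := ltz_mod _ m0.
exists ((-1) ^+ b * (r + 1)), ((-1) ^+ b * k); split.
- by rewrite -mulrA -mulrDr addrAC [r + _]addrC -E subrK signrMK.
- have r1 : 0 <= r + 1 by apply: addr_ge0.
  by rewrite normrMsign (ger0_norm r1) lezD1.
- by rewrite mulrA -expr2 sqrr_sign mul1r lerDr.
Qed.

(** * The division dynamics on values at the roots of [P] *)

Section Dynamics.

Variables (C : numClosedFieldType) (P : {poly int}) (rs : seq C).
Hypotheses (rs_uniq : uniq rs) (size_rs : size P = (size rs).+1).
Hypothesis rsP : forall z, z \in rs <-> eval_int P z = 0.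
Hypothesis rs_ge1 : {in rs, forall z, 1 <= `|z|}.

Let tr (Q : {poly int}) : C := \sum_(z <- rs) eval_int Q z.
Let N2 (Q : {poly int}) : C := \sum_(z <- rs) `|eval_int Q z| ^+ 2.
Let A : C := `|P`_0|%:~R.
Let d : C := (size rs)%:R.

Let A_ge0 : 0 <= A. Proof. by rewrite ler0z. Qed.
Let d_ge0 : 0 <= d. Proof. exact: ler0n. Qed.

Lemma P0_neq0 : P`_0 != 0.
Proof.
apply/eqP => P00; have /rs_ge1 : 0 \in rs.
  by apply/rsP; rewrite /eval_int horner_coef0 coef_map P00.
by rewrite normr0 ler10.
Qed.

Lemma root_neq0 z : z \in rs -> z != 0.
Proof. by move=> /rs_ge1 z1; rewrite -normr_gt0 (lt_le_trans ltr01). Qed.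

(** [P] has integer coefficients, so conjugation preserves its roots; this makes traces real. *)
Lemma rs_conj : perm_eq [seq z^* | z <- rs] rs.
Proof.
apply: uniq_perm => //.
  by rewrite map_inj_uniq//; apply: (can_inj (@conjCK _)).
move=> z; apply/mapP/idP => [[w /rsP w0 ->]|/rsP z0].
  by apply/rsP; rewrite eval_int_conj w0 rmorph0.
exists z^*; last by rewrite conjCK.
by apply/rsP; rewrite eval_int_conj z0 rmorph0.
Qed.

Lemma tr_conj Q : \sum_(z <- rs) (eval_int Q z)^* = tr Q.
Proof.
rewrite /tr -[RHS](perm_big _ rs_conj)/= big_map.
by apply: eq_bigr => z _; rewrite eval_int_conj.
Qed.

Lemma tr_real Q : tr Q \is Num.real.
Proof. by apply/CrealP; rewrite -[RHS]tr_conj rmorph_sum. Qed.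

(** One step [Q = e + 'X * Q1] modulo [P], seen through values at the roots. The last clause gives
    [e] the sign of the trace, and modulus at least 1, whenever the trace is nonzero. *)
Definition is_digit_step (Q : {poly int}) (e : int) (Q1 : {poly int}) : Prop :=
  [/\ (size Q1 <= (maxn (size Q) (size P)).-1)%N, `|e%:~R| <= A,
    {in rs, forall z, eval_int Q z = e%:~R + eval_int Q1 z * z} &
    `|tr Q| <= e%:~R * tr Q].

Lemma digit_step Q : exists e Q1, is_digit_step Q e Q1.
Proof.
pose b := ~~ (0 <= tr Q).
have [e [k [q0E eA e1]]] := signed_residue (Q`_0) b P0_neq0.
(* [S] has constant term [e], so dropping that term divides [S - e] by ['X]. *)
pose S := Q - k *: P.
exists e, (drop_poly 1 S); split.
- rewrite size_drop_poly subn1 -!subn1 leq_sub2r//.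
  rewrite (leq_trans (size_polyD _ _))// size_polyN geq_max leq_maxl/=.
  by rewrite (leq_trans (size_scale_leq _ _))// leq_maxr.
- by rewrite /A -intr_norm ler_int.
- move=> z /rsP z0.
  have -> : Q = k%:P * P + S by rewrite mul_polyC /S addrC subrK.
  rewrite eval_intD eval_intM z0 mulr0 add0r -{1}(poly_take_drop 1 S).
  rewrite eval_intD eval_intM expr1 eval_intX; congr (_ + _).
  rewrite -(eval_intC e z); congr eval_int; apply/polyP => i.
  rewrite coef_take_poly coefC; case: i => [|//].
  by rewrite coefB coefZ q0E mulrC addrK.
- have e1C : 1 <= (-1) ^+ b * e%:~R :> C.
    by rewrite -[(-1) ^+ b](intr_sign C) -rmorphM ler1z.
  have : `|tr Q| = (-1) ^+ b * tr Q.
    rewrite /b; case: (real_ge0P (tr_real Q)) => _ /=.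
    + by rewrite ?expr0 mul1r.
    + by rewrite ?expr1 mulN1r.
  move=> trE; have -> : e%:~R * tr Q = (-1) ^+ b * e%:~R * `|tr Q|.
    by rewrite trE mulrACA -expr2 sqrr_sign mul1r.
  by rewrite ler_peMl.
Qed.


(** The two cross terms of each squared modulus sum to the trace and its conjugate, which agree. *)
Lemma N2_shift Q (e : int) : \sum_(z <- rs) `|eval_int Q z - e%:~R| ^+ 2 =
  N2 Q - 2 * (e%:~R * tr Q) + d * e%:~R ^+ 2.
Proof.
have -> : 2 * (e%:~R * tr Q) = e%:~R * tr Q +
    e%:~R * \sum_(z <- rs) (eval_int Q z)^* by rewrite tr_conj; ring.
have -> : d * e%:~R ^+ 2 = \sum_(z <- rs) e%:~R ^+ 2.
  by rewrite big_const_seq count_predT iter_addr_0 mulr_natl.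
rewrite opprD addrA !mulr_sumr -!sumrB -big_split/=.
apply: eq_bigr => z _; rewrite !normCK rmorphB/= rmorph_int; ring.
Qed.

Section Orbit.

Variables (dig : {poly int} -> int) (T : {poly int} -> {poly int}).
Hypothesis step : forall Q, is_digit_step Q (dig Q) (T Q).

(** At a root [z], [T Q] takes the value [(Q(z) - e) / z], and dividing by [z] does not increase the
    modulus. *)
Lemma N2_step Q : N2 (T Q) + 2 * `|tr Q| <= N2 Q + d * A ^+ 2.
Proof.
have [_ eA eQ trQ] := step Q.
have : N2 (T Q) <= N2 Q - 2 * ((dig Q)%:~R * tr Q) + d * (dig Q)%:~R ^+ 2.
  rewrite -N2_shift /N2 big_seq [leRHS]big_seq; apply: ler_sum => z zs.
  rewrite eQ// [_ + eval_int _ _ * _]addrC addrK normrM lerXn2r ?nnegrE//.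
    by rewrite mulr_ge0.
  by rewrite ler_peMr// rs_ge1.
move=> /le_trans h; rewrite -lerBrDr; apply: h.
rewrite [leLHS]addrAC; apply: lerD; last by rewrite lerN2 ler_pM2l.
rewrite lerD2l ler_wpM2l// -(real_normK (realz _ _)) lerXn2r ?nnegrE//.
Qed.

Lemma N2_iter n Q :
  N2 (iter n T Q) + 2 * \sum_(j < n) `|tr (iter j T Q)| <=
  N2 Q + n%:R * (d * A ^+ 2).
Proof.
elim: n => [|n IH]; first by rewrite big_ord0 mulr0 mul0r.
have := lerD (N2_step (iter n T Q)) IH; rewrite -subr_ge0 => h.
rewrite -subr_ge0 big_ord_recr/= mulrSr; apply: etrans h.
congr (_ <= _); ring.
Qed.

(** [Q(z) z^-n] differs from the value of the [n]-th iterate at [z] by [n] digits times negative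
    powers of [z], each term of modulus at most [A]. *)
Lemma tr_iter n Q : `|\sum_(z <- rs) eval_int Q z * z^-1 ^+ n| <=
  `|tr (iter n T Q)| + n%:R * (d * A).
Proof.
elim: n Q => [|n IH] Q.
  rewrite mul0r addr0; under eq_bigr do rewrite expr0 mulr1.
  exact: lexx.
have [_ eA eQ _] := step Q.
have -> : \sum_(z <- rs) eval_int Q z * z^-1 ^+ n.+1 =
    \sum_(z <- rs) eval_int (T Q) z * z^-1 ^+ n +
    \sum_(z <- rs) (dig Q)%:~R * z^-1 ^+ n.+1.
  rewrite -big_split/= big_seq [RHS]big_seq; apply: eq_bigr => z zs.
  by rewrite eQ// exprS; have := root_neq0 zs => z0; field.
apply: le_trans (ler_normD _ _) _.
rewrite iterSr -addn1 natrD mulrDl mul1r addrA lerD//.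
apply: le_trans (ler_norm_sum _ _ _) _.
have -> : d * A = \sum_(z <- rs) A.
  by rewrite big_const_seq count_predT iter_addr_0 mulr_natl.
rewrite big_seq [leRHS]big_seq; apply: ler_sum => z zs.
rewrite normrM -[leRHS]mulr1 ler_pM// normrX normfV.
by rewrite exprn_ile1 ?invr_ge0// invf_le1 ?rs_ge1// normr_gt0 root_neq0.
Qed.

Lemma size_iter n (Q : {poly int}) :
  (size Q <= size rs)%N -> (size (iter n T Q) <= size rs)%N.
Proof.
move=> sQ; elim: n => //= n IH; have [+ _ _ _] := step (iter n T Q).
by rewrite size_rs (maxn_idPr _) // (leq_trans IH).
Qed.

Lemma N2_contracts : exists2 N0 : C, 0 <= N0 &
  forall Q, N2 Q <= N0 \/ N2 (iter (size rs) T Q) + 1 <= N2 Q.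
Proof.
have [|L L0 LP] := @power_sums_bound C [seq z^-1 | z <- rs].
  by rewrite map_inj_uniq//; apply: invr_inj.
(* [K] is 1 more than a bound on the total increase of [N2] over [d] steps, so one trace of modulus
   at least [K] forces a drop by 1. [B] bounds the values when all [d] traces stay below [K]. *)
pose K := d * (d * A ^+ 2) + 1; pose B := L * (K + d * (d * A)).
have K0 : 0 <= K by rewrite addr_ge0// !mulr_ge0// exprn_ge0.
have B0 : 0 <= B by rewrite mulr_ge0// addr_ge0// !mulr_ge0.
exists (d * B ^+ 2); first by rewrite mulr_ge0// exprn_ge0.
move=> Q.
have [/existsP[j Kj]|] :=
    boolP [exists j : 'I_(size rs), K <= `|tr (iter j T Q)|].
  right; rewrite -(lerD2r (d * (d * A ^+ 2))).
  apply: le_trans (N2_iter (size rs) Q).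
  rewrite -addrA lerD2l addrC -/K (le_trans Kj)//.
  rewrite (bigD1 j)//= mulrDr mulr_natl mulr2n -addrA lerDl.
  by rewrite addr_ge0// mulr_ge0// sumr_ge0.
rewrite negb_exists => /forallP Kj; left.
have QB : {in rs, forall z, `|eval_int Q z| <= B}.
  move=> z zs; rewrite -[z]invrK.
  apply: (LP (fun w => eval_int Q w^-1)) => [j|]; last exact: map_f.
  rewrite size_map => jn; rewrite big_map.
  under eq_bigr do rewrite invrK.
  apply: le_trans (tr_iter j Q) _; apply: lerD.
    have := Kj (Ordinal jn); rewrite -real_ltNge ?realE ?K0 ?normr_ge0//.
    exact: ltW.
  by rewrite ler_wpM2r ?mulr_ge0// ler_nat ltnW.
have -> : d * B ^+ 2 = \sum_(z <- rs) B ^+ 2.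
  by rewrite big_const_seq count_predT iter_addr_0 mulr_natl.
rewrite /N2 big_seq [leRHS]big_seq; apply: ler_sum => z zs.
by rewrite lerXn2r ?nnegrE// QB.
Qed.

Lemma height_reduction_orbit : archimedean_norm C ->
  exists M : nat, forall a Q, a \in rs ->
    exists2 p : {poly int}, forall i, `|p`_i| <= M%:Z &
      eval_int p a = eval_int Q a.
Proof.
move=> archi; have [N0 N00 NP] := N2_contracts.
have [L L0 LP] := coef_bound rs_uniq.
have [m Lm] := archi (L * (N0 + 1)).
have N10 : 0 <= N0 + 1 by rewrite addr_ge0.
(* [m] bounds the coefficients of the terminal polynomials, the other summand the digits. *)
pose M := addn m (absz P`_0); exists M => a Q ars.
pose good Q := exists2 p : {poly int}, forall i, `|p`_i| <= M%:Z &
  eval_int p a = eval_int Q a.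
have good_step S : good (T S) -> good S.
  move=> [p pM pE]; have [_ eA eS _] := step S.
  exists ((dig S)%:P + p * 'X).
    move=> i; rewrite coefD coefC coefMX; case: i => [|i]/=.
      rewrite addr0; move: eA; rewrite /A -intr_norm ler_int => /le_trans; apply.
      by rewrite /M PoszD abszE lerDr.
    by rewrite add0r.
  by rewrite eval_intD eval_intM eval_intX eval_intC pE -eS.
have good_iter n S : good (iter n T S) -> good S.
  by elim: n S => // n IH S; rewrite iterSr => /IH/good_step.
have good_small (S : {poly int}) : (size S <= size rs)%N -> N2 S <= N0 -> good S.
  move=> sS SN; exists S => // i.
  (* A modulus whose square is at most [N0] is at most [N0 + 1]; no square root is needed. *)
  have h := LP (map_poly intr S) (N0 + 1) N10.
  suff : `|S`_i|%:~R <= m%:Z%:~R :> C.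
    by rewrite ler_int => /le_trans; apply; rewrite /M PoszD lerDl.
  rewrite intr_norm -(coef_map (intr : int -> C)).
  apply: le_trans (h _ _ i) _.
  - by rewrite (leq_trans (size_poly _ _)).
  - move=> z zs; rewrite -/(eval_int S z).
    have xN : `|eval_int S z| ^+ 2 <= N0.
      apply: le_trans SN; rewrite /N2 (bigD1_seq z)//= lerDl.
      by apply: sumr_ge0 => w _; rewrite exprn_ge0.
    have [x1|/ltW x1] := real_leP (normr_real (eval_int S z)) (@real1 C).
      by rewrite (le_trans x1)// lerDr.
    by rewrite (le_trans (ler_eXnr (isT : 0 < 2)%N x1))// (le_trans xN)// lerDl.
  - by rewrite -pmulrn (le_trans _ Lm)// real_ler_norm// ger0_real// mulr_ge0.
have good_deg (S : {poly int}) : (size S <= size rs)%N -> good S.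
  (* Induction on a natural number bounding [N2 S], which each block of [d] divisions lowers by 1
     outside the bounded set. *)
  move=> sS; have [n] := archi (N2 S).
  rewrite ger0_norm; last by apply: sumr_ge0 => w _; rewrite exprn_ge0.
  elim: n S sS => [|n IH] S sS Sn.
    by apply: good_small => //; apply: le_trans Sn N00.
  have [/good_small|h] := NP S; first exact.
  apply: (good_iter (size rs)); apply: IH; first exact: size_iter.
  by rewrite -(lerD2r 1) natr1 (le_trans h).
(* While the size exceeds [d], each division lowers it by at least 1. *)
have : (size Q <= size Q + size rs)%N by rewrite leq_addr.
elim: (size Q) {1 3}Q => [|n IH] S sS; first exact: good_deg.
have [/good_deg//|sS'] := leqP (size S) (size rs).
apply: good_step; apply: IH; have [+ _ _ _] := step S.
rewrite size_rs (maxn_idPl sS') => /leq_trans; apply.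
by rewrite -ltnS prednK// (leq_trans _ sS').
Qed.

End Orbit.

Lemma height_reduction : archimedean_norm C ->
  exists M : nat, forall a Q, a \in rs ->
    exists2 p : {poly int}, forall i, `|p`_i| <= M%:Z &
      eval_int p a = eval_int Q a.
Proof.
have [dig digP] := choice digit_step; have [T TP] := choice digP.
exact: height_reduction_orbit TP.
Qed.

End Dynamics.

(** * Minimal polynomials over the rationals *)

Lemma irreducible_dvd_root (C : numClosedFieldType) (p q : {poly rat}) (z : C) :
  irreducible_poly p -> root (map_poly ratr p) z -> root (map_poly ratr q) z ->
  p %| q.
Proof.
move=> irr_p pz qz; have [g1|gp] := irredp_XsubCP irr_p (dvdp_gcdl p q).
  have cpq : coprimep (map_poly (ratr : rat -> C) p) (map_poly ratr q).
    by rewrite coprimep_map /coprimep (eqp_size g1) size_poly1.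
  by have := coprimep_root cpq pz; rewrite -[_ == 0]/(root _ _) qz.
by rewrite -(eqp_dvdl _ gp) dvdp_gcdr.
Qed.

(** In characteristic 0 the derivative is nonzero, and its degree is too small for [p] to divide
    it. *)
Lemma irreducible_separable (p : {poly rat}) :
  irreducible_poly p -> separable_poly p.
Proof.
move=> irr_p; have [sp _] := irr_p.
have p0 : p != 0 by rewrite -size_poly_gt0 ltnW.
have [g1|gp] := irredp_XsubCP irr_p (dvdp_gcdl p p^`()).
  by rewrite unlock /coprimep (eqp_size g1) size_poly1.
have p'0 : p^`() != 0.
  apply/eqP => /(congr1 (fun q : {poly rat} => q`_(size p).-2)) /eqP.
  rewrite coef0 coef_deriv; case: (size p) sp (lead_coefE p) => [|[|n]]//= _ pE.
  by rewrite -pE mulrn_eq0/= lead_coef_eq0 (negbTE p0).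
have : p %| p^`() by rewrite -(eqp_dvdl _ gp) dvdp_gcdr.
by move=> /(dvdp_leq p'0); rewrite leqNgt lt_size_deriv.
Qed.

(** A nonzero annihilating polynomial of least degree is irreducible, since one of any two factors
    vanishes at [a]. *)
Lemma minpoly_exists (C : numClosedFieldType) (a : C) :
  algebraicOver (ratr : rat -> C) a -> exists p, is_minpoly a p.
Proof.
pose Q n := `[< exists p : {poly rat},
  [/\ p != 0, size p = n & root (map_poly (ratr : rat -> C) p) a] >].
move=> [p1 p10 p1a]; have exQ : exists n, Q n.
  by exists (size p1); apply/asboolP; exists p1.
case: (ex_minnP exQ) => n /asboolP[p [p0 sp pa]] n_min.
have l0 : (lead_coef p)^-1 != 0 by rewrite invr_eq0 lead_coef_eq0.
exists ((lead_coef p)^-1 *: p); split.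
- by rewrite monicE lead_coefZ mulVf// lead_coef_eq0.
- have sc : (lead_coef p)^-1 *: p %= p by apply: eqp_scale.
  split.
    rewrite (eqp_size sc) ltnNge; apply/negP => /size1_polyC pE.
    move: pa p0; rewrite pE map_polyC rootC fmorph_eq0 => /eqP ->.
    by rewrite polyC0 eqxx.
  move=> q sq1; rewrite (eqp_dvdr _ sc) => qp.
  apply: eqp_trans (_ : p %= _); last by rewrite eqp_sym.
  have /dvdpP[r rE] := qp.
  have [r0 q0] : r != 0 /\ q != 0.
    by move: p0; rewrite rE mulf_eq0 negb_or => /andP.
  rewrite -dvdp_size_eqp// sp eqn_leq -{1}sp dvdp_leq//=.
  move: pa; rewrite rE rmorphM rootM => /orP[ra|qa]; last first.
    by apply: n_min; apply/asboolP; exists q.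
  have : (n <= size r)%N by apply: n_min; apply/asboolP; exists r.
  rewrite -sp rE size_mul//; move: sq1; rewrite -size_poly_eq0 in q0.
  case: (size q) q0 => [|[|k]]// _ _.
  by rewrite addnS /= -{2}[size r]addn0 leq_add2l.
- by rewrite map_polyZ/= rootZ// fmorph_eq0.
Qed.

Lemma map_ratr_intr (C : numClosedFieldType) (p : {poly int}) :
  map_poly (ratr : rat -> C) (map_poly intr p) = map_poly intr p.
Proof.
by rewrite -map_poly_comp; apply: eq_map_poly => x /=; rewrite rmorph_int.
Qed.

(** * Height reduction at an algebraic number *)

(** Clearing denominators in the minimal polynomial gives [P]; its roots are the conjugates,
    distinct by separability, so the dynamics applies. *)
Lemma height_reduction_property (C : numClosedFieldType) (a : C) :
  archimedean_norm C -> algebraicOver (ratr : rat -> C) a ->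
  (forall b, rat_conjugate a b -> 1 <= `|b|) ->
  exists M : nat, forall Q, exists2 p : {poly int},
    forall i, `|p`_i| <= M%:Z & eval_int p a = eval_int Q a.
Proof.
move=> archi /minpoly_exists[p [p_monic p_irr pa]] conj1.
have [P [k k0 pE]] := rat_poly_scale p.
have rootPp : root (map_poly (intr : int -> C) P) =1 root (map_poly ratr p).
  move=> z; rewrite pE map_polyZ/= rootZ ?map_ratr_intr//.
  by rewrite fmorph_eq0 invr_eq0 intr_eq0.
have P0 : map_poly (intr : int -> C) P != 0.
  rewrite -map_ratr_intr map_poly_eq0.
  apply: contraTneq p_monic => P0.
  by rewrite pE P0 scaler0 monicE lead_coef0 eq_sym oner_eq0.
have [rs rsE] := closed_field_poly_normal (map_poly (intr : int -> C) P).
have rsP z : z \in rs <-> eval_int P z = 0.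
  rewrite /eval_int -root_prod_XsubC rsE.
  rewrite -(rootZ _ _ (_ : lead_coef (map_poly (intr : int -> C) P) != 0)).
    by split => /rootP.
  by rewrite lead_coef_eq0.
have [] := @height_reduction C P rs _ _ rsP _ archi.
- rewrite -separable_prod_XsubC.
  have : separable_poly (map_poly (ratr : rat -> C) p).
    by rewrite separable_map irreducible_separable.
  rewrite pE map_polyZ/= map_ratr_intr rsE scalerA.
  rewrite (eqp_separable (eqp_scale _ _))// mulf_neq0 ?lead_coef_eq0//.
  by rewrite fmorph_eq0 invr_eq0 intr_eq0.
- have := congr1 (fun q : {poly C} => size q) rsE.
  rewrite size_scale ?lead_coef_eq0// size_prod_XsubC size_map_inj_poly//.
  exact: intr_inj.
- move=> z /rsP z0; apply: conj1; exists p => //.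
  by rewrite -rootPp; apply/rootP.
- move=> M MP; exists M => Q; apply: MP.
  by apply/rsP/rootP; rewrite rootPp.
Qed.

(** * Digit expansions and finite digit sets *)

(** The alternative 0 covers the coefficients past the last digit, as 0 may lie outside [F]. *)
Lemma digit_expansions_poly (C : numClosedFieldType) (F : set int) (a x : C) :
  digit_expansions (intr @` F) a x -> exists2 p : {poly int},
    forall i, F p`_i \/ p`_i = 0 & x = eval_int p a.
Proof.
move=> [n [e [eF ->]]].
have eF' j : exists m : int, F m /\ m%:~R = e j.
  by have [m Fm mE] := eF j; exists m.
have [f fP] := choice eF'.
exists (\poly_(i < n.+1) f (inord i)) => [i|].
  by rewrite coef_poly; case: ltnP => _; [left; case: (fP (inord i))|right].
rewrite /eval_int (@horner_coef_wide _ n.+1); last first.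
  by rewrite (leq_trans (size_poly _ _))// size_poly.
apply: eq_bigr => j _; rewrite coef_map coef_poly ltn_ord.
by rewrite inord_val /=; case: (fP j) => _ ->.
Qed.

Lemma poly_digit_expansions (C : numClosedFieldType) (F : set int) (a : C)
    (p : {poly int}) :
  (forall i, F p`_i) -> digit_expansions (intr @` F) a (eval_int p a).
Proof.
(* Expansions have at least one digit, so a zero is added on top; it lies in [F] because [pF] covers
   every index. *)
move=> pF; exists (size p), (fun j => (p`_j)%:~R); split=> [j|].
  by exists p`_j.
rewrite /eval_int (@horner_coef_wide _ (size p).+1).
  by apply: eq_bigr => j _; rewrite coef_map.
by rewrite (leq_trans (size_poly _ _)).
Qed.

Lemma finite_int_ball (M : nat) : finite_set [set x : int | `|x| <= M%:Z].
Proof.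
pose s := [seq Posz n | n <- iota 0 M.+1] ++ [seq - Posz n | n <- iota 0 M.+1].
apply: (@sub_finite_set _ _ [set` s]); last exact: finite_seq.
move=> x /= xM; rewrite mem_cat.
have xs : absz x \in iota 0 M.+1 by rewrite mem_iota/= ltnS -lez_nat abszE.
have [x0|x0] := leP 0 x.
  by apply/orP; left; apply/mapP; exists (absz x); rewrite // abszE ger0_norm.
apply/orP; right; apply/mapP; exists (absz x); rewrite // abszE ltr0_norm//.
by rewrite opprK.
Qed.

Lemma finite_int_bounded (F : set int) : finite_set F ->
  exists M : nat, forall x, F x -> `|x| <= M%:Z.
Proof.
move=> /finite_seqP[s ->]; exists (\sum_(x <- s) absz x)%N => x /= xs.
by rewrite -abszE lez_nat (big_rem x)//= leq_addr.
Qed.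

(** * Constraints on the conjugates *)

(** If [|b| < 1], the geometric series bounds every natural number by [M / (1 - |b|)]. *)
Lemma bounded_digits_norm_ge1 (C : numClosedFieldType) (b : C) (M : nat) :
  archimedean_norm C ->
  (forall m : nat, exists2 p : {poly int},
    forall i, `|p`_i| <= M%:Z & eval_int p b = m%:R) -> 1 <= `|b|.
Proof.
move=> archi repr; rewrite real_leNgt ?real1 ?normr_real//; apply/negP => b1.
have b1' : 0 < 1 - `|b| by rewrite subr_gt0.
have bound m : m%:R * (1 - `|b|) <= M%:R.
  have [p pM pE] := repr m.
  have : `|eval_int p b| <= M%:R * \sum_(i < size p) `|b| ^+ i.
    rewrite /eval_int (@horner_coef_wide _ (size p)) ?size_poly//.
    apply: le_trans (ler_norm_sum _ _ _) _; rewrite mulr_sumr.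
    apply: ler_sum => i _; rewrite coef_map/= normrM normrX.
    rewrite ler_wpM2r ?exprn_ge0//.
    by rewrite -intr_norm pmulrn ler_int.
  rewrite pE normr_nat -(ler_pM2r b1') => /le_trans; apply.
  rewrite -mulrA ler_piMr ?ler0n// mulrC -opprB mulNr -subrX1 opprB.
  by rewrite gerBl exprn_ge0.
have [m mP] := archi (M%:R / (1 - `|b|)).
have := bound m.+1; rewrite -ler_pdivlMr// => /le_trans h.
have : m.+1%:R <= m%:R :> C.
  apply: h; rewrite (le_trans _ mP)// real_ler_norm// ger0_real//.
  by rewrite divr_ge0// ltW.
by rewrite ler_nat ltnn.
Qed.

Lemma is_minpoly_uniq (C : numClosedFieldType) (a : C) p q :
  is_minpoly a p -> is_minpoly a q -> p = q.
Proof.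
move=> [pm pi pa] [qm qi qa]; apply/eqP; rewrite -eqp_monic// /eqp.
by rewrite !(irreducible_dvd_root _ pa, irreducible_dvd_root _ qa).
Qed.

Lemma conjugate_inv (C : numClosedFieldType) (a b c : C) : c != 0 ->
  rat_conjugate a b -> `|b| = 1 -> rat_conjugate a c -> rat_conjugate a c^-1.
Proof.
move=> c0 [p pmin pb] b1 [q qmin]; rewrite -(is_minpoly_uniq pmin qmin) => pc.
exists p => //; have [pm pi pa] := pmin.
(* [r] is the reversal of [p]: its nonzero roots are the inverses of those of [p]. *)
pose r := \poly_(i < size p) p`_(size p - i.+1).
have rE (z : C) : z != 0 ->
    (map_poly ratr r).[z] = z ^+ (size p).-1 * (map_poly ratr p).[z^-1].
  move=> z0; rewrite (@horner_coef_wide _ (size p)); last first.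
    by rewrite (leq_trans (size_poly _ _))// size_poly.
  rewrite (@horner_coef_wide _ (size p)) ?size_poly//.
  rewrite mulr_sumr [RHS](reindex_inj rev_ord_inj)/=; apply: eq_bigr => i _.
  rewrite !coef_map coef_poly ltn_ord/= mulrCA; congr (_ * _).
  have -> : (size p).-1 = (i + (size p - i.+1))%N.
    by case: (size p) i => [[]//|n] i /=; rewrite subSS subnKC// -ltnS.
  by rewrite exprD -mulrA -exprMn divff// expr1n mulr1.
have bV : b^-1 = b^* by rewrite invC_norm b1 expr1n invr1 mul1r.
have b0 : b != 0 by rewrite -normr_gt0 b1.
have rb : root (map_poly ratr r) b.
  rewrite rootE rE// bV.
  have -> : (map_poly (ratr : rat -> C) p).[b^*] = (map_poly ratr p).[b]^*.
    rewrite -horner_map -map_poly_comp; congr (_.[_]).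
    by apply: eq_map_poly => x; rewrite /= fmorph_rat.
  by rewrite (rootP pb) rmorph0 mulr0.
have /dvdpP[t tE] : p %| r := irreducible_dvd_root pi pb rb.
have : (map_poly (ratr : rat -> C) r).[c] = 0.
  by rewrite tE rmorphM hornerM (rootP pc) mulr0.
by rewrite rE// => /eqP; rewrite mulf_eq0 expf_eq0 (negbTE c0) andbF.
Qed.

Lemma archimedean_norm_complex (R : realType) : archimedean_norm R[i].
Proof.
move=> x; have [r ->] : exists r : R, `|x| = r%:C%C.
  by case: x => u v; eexists; rewrite normc_def; reflexivity.
exists (Num.bound `|r|); rewrite -(rmorph_nat (real_complex R)) lecR.
by rewrite (le_trans (ler_norm r))// ltW// archi_boundP.
Qed.

Theorem mainTheorem1 (R : realType) (alpha : R[i]) :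
  (exists F : set int,
     finite_set F /\
     digit_expansions (intr @` F) alpha = int_adjoin alpha)
  <->
  (algebraicOver (ratr : rat -> R[i]) alpha /\
   ((forall beta : R[i], rat_conjugate alpha beta -> `|beta| = 1) \/
    (forall beta : R[i], rat_conjugate alpha beta -> 1 < `|beta|))).
Proof.
have archi := @archimedean_norm_complex R.
split=> [[F [/finite_int_bounded[M FM] FE]]|[alg mod1]]; last first.
  have [|M MP] := height_reduction_property archi alg.
    by move=> b ab; case: mod1 => /(_ b ab) => [->//|/ltW].
  exists [set x : int | `|x| <= M%:Z]; split; first exact: finite_int_ball.
  apply/seteqP; split=> x.
    by move=> /digit_expansions_poly[p _ ->]; exists p.
  move=> [Q ->]; have [p pM pE] := MP Q.
  by rewrite -[X in digit_expansions _ _ X]pE; apply: poly_digit_expansions.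
have repr (m : nat) : exists2 p : {poly int},
    forall i, `|p`_i| <= M%:Z & eval_int p alpha = m%:R.
  have : int_adjoin alpha m%:R.
    by exists m%:Z%:P; rewrite map_polyC hornerC pmulrn.
  rewrite -FE => /digit_expansions_poly[p pF pE]; exists p => // i.
  by case: (pF i) => [/FM//|->]; rewrite normr0.
have alg : algebraicOver (ratr : rat -> R[i]) alpha.
  (* As [M + 1] exceeds every coefficient of [p], the difference has a nonzero constant term. *)
  have [p pM pE] := repr M.+1.
  exists (map_poly intr (p - M.+1%:Z%:P)).
    rewrite -(map_poly0 (intr : int -> rat)) (inj_eq (map_inj_poly _ _))//.
      apply: contraTneq (pM 0) => /subr0_eq ->.
      by rewrite coefC/= ger0_norm// lez_nat ltnn.
    exact: intr_inj.
  rewrite map_ratr_intr rootE -/(eval_int _ _) -polyCN eval_intD eval_intC pE.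
  by rewrite rmorphN/= -pmulrn subrr.
have conj1 b : rat_conjugate alpha b -> 1 <= `|b|.
  move=> [q [qm qi qa] qb]; apply: (bounded_digits_norm_ge1 (M := M)) => // m.
  have [p pM pE] := repr m; exists p => //.
  (* Divisibility by the minimal polynomial carries the expansion of [m] from [alpha] over to
     [b]. *)
  have /dvdpP[t tE] : q %| map_poly intr (p - m%:Z%:P).
    apply: irreducible_dvd_root qi qa _.
    rewrite map_ratr_intr rootE -/(eval_int _ _) -polyCN eval_intD eval_intC pE.
    by rewrite rmorphN/= -pmulrn subrr.
  have : eval_int (p - m%:Z%:P) b = 0.
    by rewrite /eval_int -map_ratr_intr tE rmorphM hornerM (rootP qb) mulr0.
  rewrite -polyCN eval_intD eval_intC rmorphN/= -pmulrn => /eqP.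
  by rewrite subr_eq0 => /eqP.
split=> //.
have [[b ab b1]|nb] := pselect (exists2 b, rat_conjugate alpha b & `|b| = 1).
  left=> c ac; apply/eqP; rewrite eq_le conj1// andbT.
  have c0 : c != 0 by rewrite -normr_gt0 (lt_le_trans ltr01)// conj1.
  (* [c^-1] is a conjugate too, so its modulus is also at least 1. *)
  have := conj1 _ (conjugate_inv c0 ab b1 ac).
  by rewrite normfV invf_ge1 // normr_gt0.
right=> c ac; rewrite lt_neqAle conj1// andbT eq_sym.
by apply/eqP => c1; apply: nb; exists c.
Qed.
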